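(* Let $\chi_{f,0}(\mathbb{R}^2)=\sup\{\chi_f(G): G \text{ a finite unit distance graph in } \mathbb{R}^2\}$, let $\alpha_1(\mathbb{R}^2)=\inf\{\alpha(G)/|G|: G \text{ a finite unit distance graph in } \mathbb{R}^2\}$, and let $\rho(\mathbb{R}^2)=1/\alpha_1(\mathbb{R}^2)$. Then $\chi_{f,0}(\mathbb{R}^2)=\rho(\mathbb{R}^2)$.
   Context: A unit distance graph in the plane is a graph whose vertex set is a set $X\subseteq\mathbb{R}^2$, with an edge between $x,y\in X$ iff $|x-y|=1$. For a finite graph $G$, $\alpha(G)$ is its independence number and $|G|$ its number of vertices. A fractional colouring of a finite graph $G$ is a function $\gamma$ from the independent sets of $G$ to $[0,\infty)$ such that for every vertex $x$, the sum of $\gamma(S)$ over independent sets $S\ni x$ is at least $1$; the fractional chromatic number $\chi_f(G)$ is the minimum of $\sum_S\gamma(S)$ over all fractional colourings. *)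

(* Defs.v *)
From HB Require Import structures.
From mathcomp Require Import all_boot all_order all_algebra finmap.
From mathcomp Require Import all_classical all_reals all_analysis.
Set Implicit Arguments.
Unset Strict Implicit.
Unset Printing Implicit Defensive.
Import Order.TTheory GRing.Theory Num.Theory.
Import numFieldNormedType.Exports.
Local Open Scope classical_set_scope.
Local Open Scope ring_scope.

(* A finite graph is a finType V of vertices with an adjacency relation e. *)

Definition independent (V : finType) (e : rel V) (S : {set V}) : bool :=
  [forall x in S, forall y in S, ~~ e x y].

Definition indep_num (V : finType) (e : rel V) : nat :=
  \max_(S : {set V} | independent e S) #|S|.

(* The sums range over independent sets only, so that the values of gamma at
   the other sets are irrelevant. *)
Definition fractional_colouring (R : realType) (V : finType) (e : rel V)
    (gamma : {set V} -> R) : Prop :=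
  (forall S, independent e S -> 0 <= gamma S) /\
  (forall x, 1 <= \sum_(S : {set V} | independent e S && (x \in S)) gamma S).

Definition weight (R : realType) (V : finType) (e : rel V)
    (gamma : {set V} -> R) : R :=
  \sum_(S : {set V} | independent e S) gamma S.

(* For irreflexive e the infimum is attained, see frac_chrom_num_min. *)
Definition frac_chrom_num (R : realType) (V : finType) (e : rel V) : R :=
  inf [set weight e gamma | gamma in fractional_colouring (R := R) e].

Lemma frac_chrom_num_min (R : realType) (V : finType) (e : rel V) :
  irreflexive e ->
  exists2 gamma : {set V} -> R, fractional_colouring e gamma &
    frac_chrom_num R e = weight e gamma /\
    forall gamma' : {set V} -> R, fractional_colouring e gamma' ->
      weight e gamma <= weight e gamma'.
Proof.
move=> eirr; pose n := #|{set V}|.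
pose g (v : 'rV[R]_n) (S : {set V}) := v ord0 (enum_rank S).
pose B := [set v : 'rV[R]_n | forall i, v ord0 i \in `[0, 1]].
pose C := \bigcap_(x in [set: V]) [set v : 'rV[R]_n |
  1 <= \sum_(S : {set V} | independent e S && (x \in S)) g v S].
have gcont (P : pred {set V}) : continuous (fun v => \sum_(S | P S) g v S).
  move=> v; apply: (@cvg_big _ _ _ _ _ _ _ (nbhs v)) => [|S _].
    exact: add_continuous.
  exact: coord_continuous.
have cptA : compact (C `&` B).
  rewrite setIC; apply: compact_closedI.
    have -> : B = [set v : 'rV[R]_n | forall i, `[0, 1]%classic (v ord0 i)] by [].
    apply: (@rV_compact R n (fun=> `[0, 1]%classic)) => i.
    exact: segment_compact.
  apply: closed_bigI => x _.
  apply: (@closed_comp _ _ _ [set y : R | 1 <= y]) => [v _|]; first exact: gcont.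
  exact: closed_ge.
pose tr (h : {set V} -> R) : 'rV[R]_n := \row_i
  if independent e (enum_val i) then Num.min (h (enum_val i)) 1 else 0.
have gtr h S : g (tr h) S = if independent e S then Num.min (h S) 1 else 0.
  by rewrite /g mxE enum_rankK.
have trA h : fractional_colouring e h -> (C `&` B) (tr h).
  move=> [h0 h1]; split => [x _ /=|i /=]; last first.
    rewrite mxE in_itv /=; case: ifPn => [iS|_]; last by rewrite lexx ler01.
    by rewrite le_min h0// ler01 ge_min lexx orbT.
  have tr0 S : 0 <= g (tr h) S.
    by rewrite gtr; case: ifPn => // iS; rewrite le_min h0// ler01.
  have [/existsP[S /andP[PS hS]]|] :=
    boolP [exists S, (independent e S && (x \in S)) && (1 <= h S)].
    rewrite (bigD1 S)//= gtr (andP PS).1 min_r// lerDl.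
    by rewrite sumr_ge0.
  rewrite negb_exists => /forallP hlt.
  rewrite (le_trans (h1 x))// ler_sum// => S PS.
  move: (hlt S); rewrite PS/= -ltNge => /ltW hS.
  by rewrite gtr (andP PS).1 min_l.
have gA v : (C `&` B) v -> fractional_colouring e (g v).
  move=> [Cv Bv]; split => [S _|x]; last exact: (Cv x).
  by have := Bv (enum_rank S); rewrite in_itv /= => /andP[].
have A0 : C `&` B !=set0.
  exists (tr (fun=> 1)); apply: trA; split => [S _|x]; first exact: ler01.
  have ix : independent e [set x].
    apply/forallP => y; apply/implyP; rewrite inE => /eqP ->.
    by apply/forallP => z; apply/implyP; rewrite inE => /eqP ->; rewrite eirr.
  by rewrite (bigD1 [set x]%SET) ?ix ?set11//= lerDl sumr_ge0.
have wcont : {within C `&` B, continuous (fun v => weight e (g v))}.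
  by apply: continuous_subspaceT => v; exact: gcont.
have [v] := compact_EVT_min A0 cptA wcont.
rewrite inE => /gA vA vmin.
have gmin h : fractional_colouring e h -> weight e (g v) <= weight e h.
  move=> hh; have := vmin (tr h); rewrite inE => /(_ (trA _ hh)) /le_trans; apply.
  by apply: ler_sum => S iS; rewrite gtr iS ge_min lexx.
exists (g v) => //; split => //; apply/eqP; rewrite eq_le; apply/andP; split.
  apply: ge_inf; last by exists (g v).
  by exists (weight e (g v)) => _ [h hh <-]; exact: gmin.
apply: lb_le_inf; first by exists (weight e (g v)), (g v).
by move=> _ [h hh <-]; exact: gmin.
Qed.

(* The library's norm on row vectors is the sup norm. *)
Definition euclidean_dist (R : realType) (n : nat) (x y : 'rV[R]_n) : R :=
  Num.sqrt (\sum_i (x 0 i - y 0 i) ^+ 2).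

Definition unit_dist (R : realType) (X : {fset 'rV[R]_2}) : rel X :=
  fun x y => euclidean_dist (val x) (val y) == 1.

Lemma unit_dist_irr (R : realType) (X : {fset 'rV[R]_2}) :
  irreflexive (@unit_dist R X).
Proof.
move=> x; rewrite /unit_dist /euclidean_dist big1 => [|i _].
  by rewrite sqrtr0 eq_sym oner_eq0.
by rewrite subrr expr0n.
Qed.

Lemma unit_dist_sym (R : realType) (X : {fset 'rV[R]_2}) :
  symmetric (@unit_dist R X).
Proof.
move=> x y; rewrite /unit_dist /euclidean_dist.
by under eq_bigr do rewrite -sqrrN opprB.
Qed.

Definition chi_f0 (R : realType) : \bar R :=
  ereal_sup [set (frac_chrom_num R (@unit_dist R X))%:E
            | X in [set: {fset 'rV[R]_2}]].

(* The empty graph is excluded, since its ratio would be 0 / 0 = 0. *)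
Definition alpha1 (R : realType) : \bar R :=
  ereal_inf [set ((indep_num (@unit_dist R X))%:R / #|` X|%:R)%:E
            | X in [set X : {fset 'rV[R]_2} | X != fset0]].

(* In \bar R, 0^-1 = +oo. *)
Definition rho (R : realType) : \bar R := (1 / alpha1 R)%E.

(* Main.v *)
(* A random translate of an independent set of a finite Y, intersected with X,
   is a random independent set of X; when the translations g range over a
   finite Y' containing Y - X, every point of X is covered with probability
   alpha(Y) / |Y'|, so chi_f(X) <= |Y'| / alpha(Y).  Taking for Y the sums of
   elements of -X with all multiplicities at most N and for Y' the same with
   N + 1, polynomial growth of |Y| makes |Y'| / |Y| come arbitrarily close
   to 1, hence chi_f(X) <= 1 / alpha_1.  The converse inequality is
   |G| <= alpha(G) chi_f(G). *)
Require Import Defs.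
From mathcomp Require Import all_boot all_order all_algebra finmap.
From mathcomp Require Import all_classical all_reals ereal.
Set Implicit Arguments.
Unset Strict Implicit.
Unset Printing Implicit Defensive.
Import Order.TTheory GRing.Theory Num.Theory.
Local Open Scope ring_scope.

(** * Fractional colourings of finite graphs *)

Section Graphs.
Variables (R : realType) (V : finType) (e : rel V).

Lemma independentP (S : {set V}) :
  reflect {in S &, forall x y, ~~ e x y} (independent e S).
Proof.
apply: (iffP forall_inP) => [h x y xS yS|h x xS].
  by have /forall_inP := h x xS; apply.
by apply/forall_inP => y; exact: h.
Qed.

Lemma independent1 (x : V) : irreflexive e -> independent e [set x].
Proof.
by move=> eirr; apply/independentP => y z /set1P-> /set1P->; rewrite eirr.
Qed.

Lemma leq_indep_num (S : {set V}) : independent e S -> (#|S| <= indep_num e)%N.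
Proof. exact: (@leq_bigmax_cond _ _ (fun S : {set V} => #|S|)). Qed.

Lemma indep_num_gt0 (x : V) : irreflexive e -> (0 < indep_num e)%N.
Proof.
by move=> /(independent1 x)/leq_indep_num; apply: leq_trans; rewrite cards1.
Qed.

Lemma indep_numP : exists2 S : {set V}, independent e S & #|S| = indep_num e.
Proof.
have i0 : independent e finset.set0.
  by apply/independentP => x y; rewrite finset.in_set0.
have [|S iS E] := @eq_bigmax_cond _ (independent e) (fun S : {set V} => #|S|).
  by apply/card_gt0P; exists finset.set0.
by exists S.
Qed.

(** Sum the covering condition of an optimal colouring over all vertices and exchange the sums: each
    independent [S] is then counted [#|S|] times. *)
Lemma card_le_indep_num_frac_chrom_num : irreflexive e ->
  #|V|%:R <= (indep_num e)%:R * frac_chrom_num R e.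
Proof.
move=> eirr.
have [gamma [gamma0 gamma1] [-> _]] := frac_chrom_num_min R eirr.
have -> : #|V|%:R = \sum_(x : V) (1 : R) by rewrite sumr_const.
apply: le_trans (ler_sum _ (fun x _ => gamma1 x)) _.
rewrite (exchange_big_dep (independent e)) /=; last by move=> x S _ /andP[].
rewrite mulr_sumr ler_sum // => S iS; rewrite iS /= sumr_const -[leLHS]mulr_natl.
by rewrite ler_wpM2r ?gamma0 // ler_nat leq_indep_num.
Qed.

(** Each index carries weight [1 / n]. Since [T] may repeat sets, [gamma S] collects the weights of
    the whole fibre over [S]. *)
Lemma frac_chrom_num_le_cover (I : finType) (T : I -> {set V}) (n : nat) :
  irreflexive e -> (0 < n)%N -> (forall i, independent e (T i)) ->
  (forall x, (n <= #|[set i | x \in T i]|)%N) ->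
  frac_chrom_num R e <= #|I|%:R / n%:R.
Proof.
move=> eirr n0 iT cover; have n0R : 0 < n%:R :> R by rewrite ltr0n.
pose gamma S : R := \sum_(i | T i == S) n%:R^-1.
have fibre (P : pred {set V}) :
    \sum_(S | P S) gamma S = #|[set i | P (T i)]|%:R / n%:R.
  rewrite /gamma (exchange_big_dep (fun i => P (T i))) /=.
    under eq_bigr => i PTi.
      rewrite (big_pred1 (T i)); last first.
        by move=> S /=; rewrite eq_sym andbC; case: eqP => // ->; rewrite PTi.
      over.
    by rewrite sumr_const -[LHS]mulr_natl cardsE.
  by move=> S i PS /eqP->.
have gammaP : fractional_colouring e gamma.
  split=> [S _|x]; first by rewrite sumr_ge0 // => i _; rewrite invr_ge0 ltW.
  rewrite fibre ler_pdivlMr // mul1r ler_nat.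
  rewrite (leq_trans (cover x)) // subset_leq_card //; apply/fintype.subsetP => i.
  by rewrite !inE iT.
have [g _ [-> /(_ _ gammaP)/le_trans]] := frac_chrom_num_min R eirr.
apply; rewrite /weight fibre // ler_wpM2r ?invr_ge0 ?(ltW n0R) // ler_nat.
exact: max_card.
Qed.

End Graphs.

(** * Covering by translates *)

Lemma euclidean_distDl (R : realType) (n : nat) (g x y : 'rV[R]_n) :
  euclidean_dist (g + x) (g + y) = euclidean_dist x y.
Proof.
rewrite /euclidean_dist; congr Num.sqrt; apply: eq_bigr => i _.
by rewrite !mxE opprD addrACA subrr add0r.
Qed.

Lemma frac_chrom_num_le_translates (R : realType) (X Y Y' : {fset 'rV[R]_2}) :
  Y != fset0 -> (forall x y, x \in X -> y \in Y -> y - x \in Y') ->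
  frac_chrom_num R (@unit_dist R X) <=
    #|` Y'|%:R / (indep_num (@unit_dist R Y))%:R.
Proof.
move=> /fset0Pn[y0 Yy0] sub.
have [S iS cS] := indep_numP (@unit_dist R Y).
(* [T g] is the trace on [X] of [S - g], with [S] a maximum independent set of [Y]. *)
pose T (g : Y') := [set x : X | [exists s in S, val s == val g + val x]].
rewrite cardfE; apply: (@frac_chrom_num_le_cover _ _ _ _ T).
- exact: unit_dist_irr.
- exact: (indep_num_gt0 [` Yy0]%fset (@unit_dist_irr _ _)).
- move=> g; apply/independentP => x y; rewrite !inE.
  move=> /exists_inP[s sS /eqP sE] /exists_inP[t tS /eqP tE].
  have /independentP/(_ s t sS tS) := iS.
  by rewrite /unit_dist sE tE euclidean_distDl.
- move=> x; rewrite -cS.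
  (* The translations [s - x], for [s] in [S], are distinct elements of [Y'] whose traces contain
     [x]. *)
  pose f (s : Y) : Y' := [` sub _ _ (valP x) (valP s)]%fset.
  have finj : injective f.
    by move=> s t /(congr1 val) /= /addIr /val_inj.
  rewrite -(card_imset _ finj) subset_leq_card //.
  apply/fintype.subsetP => _ /imsetP[s sS ->]; rewrite !inE.
  by apply/exists_inP; exists s => //=; rewrite subrK.
Qed.

(** * Iterated sumsets of [-X] *)

Definition neg_sums (R : realType) (X : {fset 'rV[R]_2}) (N : nat) :=
  [fset - \sum_(x : X) val x *+ f x | f : {ffun X -> 'I_N.+1} in predT]%fset.

Section NegSums.
Variables (R : realType) (X : {fset 'rV[R]_2}).

Lemma neg_sums_neq0 N : neg_sums X N != fset0.
Proof.
apply/fset0Pn; exists (- \sum_(x : X) val x *+ [ffun=> ord0 : 'I_N.+1] x).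
by apply/imfsetP; exists [ffun=> ord0].
Qed.

Lemma card_neg_sums_le N : (#|` neg_sums X N| <= N.+1 ^ #|` X|)%N.
Proof.
apply: leq_trans (leq_imfset_card _ _ _) _.
by rewrite -cardE card_ffun card_ord cardfE.
Qed.

(** Subtracting [x] raises its multiplicity by one, hence the passage from [N] to [N.+1]. *)
Lemma neg_sumsB N x y :
  x \in X -> y \in neg_sums X N -> y - x \in neg_sums X N.+1.
Proof.
move=> Xx /imfsetP[f _ ->]; apply/imfsetP.
pose k (z : X) := (f z + (z == [` Xx]%fset))%N.
have kN z : (k z < N.+2)%N.
  rewrite ltnS (@leq_trans (f z).+1) ?ltn_ord // -[leqRHS]addn1.
  by rewrite leq_add2l leq_b1.
exists [ffun z => Ordinal (kN z)] => //=.
under [in RHS]eq_bigr do rewrite ffunE /= mulrnDr.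
rewrite big_split /= opprD; congr (_ - _).
rewrite (bigD1 [` Xx]%fset) //= eqxx mulr1n big1 ?addr0 // => z /negbTE->.
by rewrite mulr0n.
Qed.

End NegSums.

(** * Polynomial against exponential growth *)

Lemma exp_gt_poly (R : realType) (d : nat) (c : R) :
  1 < c -> exists N : nat, (N.+1 ^ d)%:R < c ^+ N.
Proof.
move=> c1; pose t := c - 1; have t0 : 0 < t by rewrite subr_gt0.
have bernoulli m : m%:R * t <= c ^+ m.
  have -> : c = 1 + t by rewrite addrC subrK.
  elim: m => [|m IH]; first by rewrite mul0r expr0.
  have h1 : 1 <= (1 + t) ^+ m by rewrite exprn_ege1 // lerDl ltW.
  by rewrite exprS mulrDl mul1r -natr1 mulrDl mul1r lerD // ler_peMr // ltW.
(* For [N = (m+1)(d+1)], Bernoulli gives [c^N >= ((m+1)t)^(d+1)], while [(N+1)^d <= ((m+1)(d+2))^d];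
   the former wins once [m+1 > K]. *)
pose K : R := (d.+2 ^ d)%:R / t ^+ d.+1.
have [m] : exists m : nat, K < m.+1%:R.
  have K0 : 0 <= K by rewrite divr_ge0 // exprn_ge0 // ltW.
  exists (Num.bound K); apply: lt_trans (archi_boundP K0) _.
  by rewrite ltr_nat.
rewrite ltr_pdivrMr ?exprn_gt0 // => Km.
exists (m.+1 * d.+1)%N; rewrite exprM.
apply: lt_le_trans (_ : (m.+1%:R * t) ^+ d.+1 <= _); last first.
  have c0 : 0 <= c by rewrite ltW // (lt_trans ltr01).
  by rewrite lerXn2r ?nnegrE ?mulr_ge0 ?exprn_ge0 ?(ltW t0).
rewrite exprMn exprSr -mulrA.
apply: le_lt_trans (_ : _ <= (m.+1 ^ d)%:R * (d.+2 ^ d)%:R) _.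
  rewrite -natrM -expnMn !natrX lerXn2r ?nnegrE // ler_nat.
  by rewrite [leqRHS]mulnS addSn ltnS leq_addl.
by rewrite -natrX ltr_pM2l // ltr0n expn_gt0.
Qed.

(** If every step multiplied [u] by more than [c], then [u N >= c^N] for all [N], against the
    polynomial bound. *)
Lemma poly_growth_ratio (R : realType) (u : nat -> nat) (d : nat) (c : R) :
  1 < c -> (0 < u 0)%N -> (forall N, (u N <= N.+1 ^ d)%N) ->
  exists N, (u N.+1)%:R <= c * (u N)%:R.
Proof.
move=> c1 u0 ub; apply: contrapT => /forallNP H.
have [N] := exp_gt_poly d c1; apply/negP; rewrite -leNgt.
apply: le_trans (_ : (u N)%:R <= _); last by rewrite ler_nat.
elim: N => [|N IH]; first by rewrite expr0 ler1n.
have /negP := H N; rewrite -ltNge => /ltW; apply: le_trans.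
by rewrite exprS ler_wpM2l // ltW // (lt_trans ltr01).
Qed.

(** * Comparison of the two constants *)

Lemma frac_chrom_num_le_inv (R : realType) (a : R) (X : {fset 'rV[R]_2}) :
  0 < a -> (forall Y : {fset 'rV[R]_2}, Y != fset0 ->
    a <= (indep_num (@unit_dist R Y))%:R / #|` Y|%:R) ->
  frac_chrom_num R (@unit_dist R X) <= a^-1.
Proof.
move=> a0 ha; apply/ler_addgt0Pr => eps eps0.
(* The growth ratio is chosen so that, divided by [a], it equals [a^-1 + eps]. *)
have c1 : 1 < 1 + a * eps by rewrite ltrDl mulr_gt0.
have [|N hN] := poly_growth_ratio c1 _ (card_neg_sums_le X).
  by rewrite cardfs_gt0 neg_sums_neq0.
have Y0 := neg_sums_neq0 X N.
apply: le_trans (frac_chrom_num_le_translates Y0 (@neg_sumsB _ X N)) _.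
have cY : 0 < #|` neg_sums X N|%:R :> R by rewrite ltr0n cardfs_gt0.
have := ha _ Y0; rewrite ler_pdivlMr // => hi.
have i0 := lt_le_trans (mulr_gt0 a0 cY) hi.
rewrite ler_pdivrMr //; apply: le_trans hN _.
have -> : a^-1 + eps = (1 + a * eps) / a.
  by rewrite mulrDl mul1r mulrAC mulfV ?gt_eqF // mul1r.
rewrite -mulrA ler_wpM2l ?(ltW (lt_trans ltr01 c1)) //.
by rewrite mulrC ler_pdivlMr // mulrC.
Qed.

Lemma alpha1_ge (R : realType) (r : R) :
  (forall Y : {fset 'rV[R]_2}, Y != fset0 ->
    r <= (indep_num (@unit_dist R Y))%:R / #|` Y|%:R) ->
  (r%:E <= alpha1 R)%E.
Proof.
by move=> h; apply: le_ereal_inf_tmp => _ [Y Y0 <-]; rewrite lee_fin h.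
Qed.

Theorem theorem2 (R : realType) : chi_f0 R = rho R.
Proof.
have alpha1_le (Y : {fset 'rV[R]_2}) : Y != fset0 ->
    (alpha1 R <= ((indep_num (@unit_dist R Y))%:R / #|` Y|%:R)%:E)%E.
  by move=> Y0; apply: ereal_inf_lbound; exists Y.
have alpha1_ge0 : (0 <= alpha1 R)%E.
  by apply: alpha1_ge => Y _; rewrite divr_ge0.
have p0 : [fset (0 : 'rV[R]_2)]%fset != fset0.
  by apply/fset0Pn; exists 0; rewrite inE.
have chi_ub X : ((frac_chrom_num R (@unit_dist R X))%:E <= chi_f0 R)%E.
  by apply: ereal_sup_ubound; exists X.
apply/eqP; rewrite eq_le; apply/andP; split.
  apply: ge_ereal_sup => _ [X _ <-]; rewrite /rho.
  (* If [alpha1 R] is 0, then [rho R] is [+oo]; the one-point graph excludes [+oo] and nonnegativity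
     excludes [-oo]. *)
  move: alpha1_le alpha1_ge0; case: (alpha1 R) => [a ale||ale].
  - rewrite lee_fin le0r => /predU1P[->|a0].
      by rewrite inve0 mul1e leey.
    rewrite inver gt_eqF // mul1e lee_fin; apply: frac_chrom_num_le_inv a0 _ => Y Y0.
    by have := ale Y Y0; rewrite lee_fin.
  - by move=> /(_ _ p0).
  - by [].
(* The value [-oo] is excluded by the empty graph, which takes part in the supremum. *)
case E : (chi_f0 R) chi_ub => [r||] chi_ub; last 2 first.
- by rewrite leey.
- by have := chi_ub fset0.
have key (Y : {fset 'rV[R]_2}) :
    #|` Y|%:R <= (indep_num (@unit_dist R Y))%:R * r.
  rewrite cardfE; apply: le_trans (card_le_indep_num_frac_chrom_num R _) _.
    exact: unit_dist_irr.
  by rewrite ler_wpM2l // -lee_fin.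
(* The one-point graph gives [1 <= alpha * r], impossible for [r <= 0]. *)
have r0 : 0 < r.
  have := key [fset 0]%fset; rewrite cardfs1 ltNge => h1; apply/negP => r0.
  have := le_trans h1 (mulr_ge0_le0 (ler0n _ _) r0).
  by rewrite leNgt ltr01.
have : (r^-1%:E <= alpha1 R)%E.
  apply: alpha1_ge => Y Y0.
  by rewrite ler_pdivlMr ?ltr0n ?cardfs_gt0 // mulrC ler_pdivrMr.
rewrite /rho; move: (alpha1_le _ p0); case: (alpha1 R) => // a _.
rewrite lee_fin => ra; have a0 : 0 < a by apply: lt_le_trans ra; rewrite invr_gt0.
by rewrite inver gt_eqF // mul1e lee_fin invf_ple ?posrE.
Qed.
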